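(* Let $\mathcal{R}$ be a ring with unit $1\neq 0$ and with an involution $x\mapsto x^*$. Let $a,b,c\in\mathcal{R}$ be such that $a$ and $c$ are Moore-Penrose invertible, let $\widetilde{b}\in\mathcal{R}$, and put $p=a^\dagger abcc^\dagger$ and $q=cc^\dagger \widetilde{b} a^\dagger a$. Then the following conditions are equivalent: (i) $abc$ is Moore-Penrose invertible and $(abc)^{\dagger}=c^\dagger \widetilde{b}a^\dagger$; (iv) $q\in p\{1\}$, $a^*ap\mathcal{R}\supseteq q^*\mathcal{R}$ and $cc^*p^*\mathcal{R}\subseteq q\mathcal{R}$; (v) $abc$ is right $*$-cancellable, $pq=(pq)^2$, $a^*ap\mathcal{R}\supseteq q^*\mathcal{R}$ and $cc^*p^*\mathcal{R}\subseteq q\mathcal{R}$; (vi) $q\in p\{2\}$, $a^*ap\mathcal{R}\supseteq q^*\mathcal{R}$ and $cc^*p^*\mathcal{R}\subseteq q\mathcal{R}$.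
   Context: $\mathcal{R}$ is a (not necessarily commutative) ring with unit $1\neq 0$ and an involution $x\mapsto x^*$, i.e. $(x^* )^*=x$, $(x+y)^*=x^*+y^*$, $(xy)^*=y^*x^*$ for all $x,y\in\mathcal{R}$. For $x\in\mathcal{R}$, the four Penrose equations for $y\in\mathcal{R}$ are: (1) $xyx=x$; (2) $yxy=y$; (3) $(xy)^*=xy$; (4) $(yx)^*=yx$. The element $x$ is Moore-Penrose invertible if some $y\in\mathcal{R}$ satisfies all four; such $y$ is then unique and denoted $x^\dagger$. For a set of indices, $x\{i,\ldots,j\}$ denotes the set of all $y\in\mathcal{R}$ satisfying equations $(i),\ldots,(j)$; thus $x\{1\}=\{y: xyx=x\}$ and $x\{2\}=\{y: yxy=y\}$. An element $x\in\mathcal{R}$ is right $*$-cancellable if for all $z\in\mathcal{R}$, $zxx^*=0$ implies $zx=0$. For $x\in\mathcal{R}$, $x\mathcal{R}=\{xr: r\in\mathcal{R}\}$. *)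

(* Defs.v *)
From mathcomp Require Import all_boot all_algebra.
From mathcomp Require Export boolp classical_sets.
Set Implicit Arguments.
Unset Strict Implicit.
Unset Printing Implicit Defensive.
Import GRing.Theory.
Local Open Scope ring_scope.
Local Open Scope classical_set_scope.

Definition ring_involution (R : nzRingType) (star : R -> R) : Prop :=
  [/\ involutive star,
      {morph star : x y / x + y} &
      forall x y : R, star (x * y) = star y * star x].

Definition inverses1 (R : nzRingType) (x : R) : set R :=
  [set y | x * y * x = x].

Definition inverses2 (R : nzRingType) (x : R) : set R :=
  [set y | y * x * y = y].

Definition inverses3 (R : nzRingType) (star : R -> R) (x : R) : set R :=
  [set y | star (x * y) = x * y].

Definition inverses4 (R : nzRingType) (star : R -> R) (x : R) : set R :=
  [set y | star (y * x) = y * x].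

Definition MP_inverses (R : nzRingType) (star : R -> R) (x : R) : set R :=
  inverses1 x `&` inverses2 x `&` inverses3 star x `&` inverses4 star x.

Definition MP_invertible (R : nzRingType) (star : R -> R) (x : R) : Prop :=
  exists y, MP_inverses star x y.

(* The junk value [0] is taken when [x] is not Moore-Penrose invertible;
   otherwise see [MP_invP] and [MP_inv_uniq]. *)
Definition MP_inv (R : nzRingType) (star : R -> R) (x : R) : R :=
  xget 0 (MP_inverses star x).

Definition right_star_cancellable (R : nzRingType) (star : R -> R) (x : R) :
  Prop := forall z : R, z * x * star x = 0 -> z * x = 0.

Definition right_ideal (R : nzRingType) (x : R) : set R :=
  [set x * r | r in [set: R]].

Lemma MP_invP (R : nzRingType) (star : R -> R) (x : R) :
  MP_invertible star x -> MP_inverses star x (MP_inv star x).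
Proof. by move=> [y xy]; apply: (@xgetPex _ 0 (MP_inverses star x)); exists y. Qed.

Lemma MP_inv_uniq (R : nzRingType) (star : R -> R) (x y : R) :
  ring_involution star -> MP_inverses star x y -> MP_inv star x = y.
Proof.
move=> [_ _ starM] xy.
have /MP_invP : MP_invertible star x by exists y.
move: (MP_inv star x) xy => z.
rewrite /MP_inverses /= => -[[[y1 y2] y3] y4] [[[z1 z2] z3] z4].
rewrite /inverses1 /inverses2 /inverses3 /inverses4 /= in y1 y2 y3 y4 z1 z2 z3 z4.
have xE : x * y = x * z.
  by rewrite -{1}z1 -mulrA -z3 -y3 -starM mulrA y1 z3.
have Ex : y * x = z * x.
  by rewrite -{1}z1 -(mulrA x) mulrA -y4 -z4 -starM -mulrA (mulrA x) y1 z4.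
by rewrite -z2 -y2 -(mulrA z) -xE mulrA -Ex.
Qed.

(* Main.v *)
(* Put A = a^* a and C = c c^*; they are invertible in the corners cut out by
   the projections E = a^+ a and F = c c^+, and abc = a p c,
   c^+ bt a^+ = c^+ q a^+.  The Penrose equations for the latter pair then read
   pqp = p, qpq = q, with A p q and q p C self-adjoint.  The inclusions say
   A^-1 q^* = p r and C p^* = q s.  Each of them, together with one of
   qpq = q and pqp = p, forces one self-adjointness condition and the other
   of these two equations. *)
Require Import Defs.
From mathcomp Require Import all_boot all_algebra.
From mathcomp Require Import boolp classical_sets.
Set Implicit Arguments.
Unset Strict Implicit.
Unset Printing Implicit Defensive.
Import GRing.Theory.
Local Open Scope ring_scope.
Local Open Scope classical_set_scope.

Lemma MP_inversesP (R : nzRingType) (star : R -> R) (x y : R) :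
  MP_inverses star x y <->
  [/\ x * y * x = x, y * x * y = y,
      star (x * y) = x * y & star (y * x) = y * x].
Proof. by split=> [[[[? ?] ?] ?]|[? ? ? ?]]. Qed.

Lemma right_ideal_subE (R : nzRingType) (x y : R) :
  (right_ideal x `<=` right_ideal y) = (exists r, x = y * r).
Proof.
apply/propext; split=> [sxy|[r ->] _ [s _ <-]]; last by exists (r * s); rewrite ?mulrA.
have [|r _ yr] := sxy x; first by exists 1; rewrite ?mulr1.
by exists r.
Qed.

(** As [y * x] is self-adjoint, [x = x * star x * star y]: the factor [x * star x] already sits
    inside [x]. *)
Lemma MP_invertible_right_star_cancellable (R : nzRingType) (star : R -> R)
    (x : R) :
  ring_involution star -> MP_invertible star x -> right_star_cancellable star x.
Proof.
move=> [_ _ starM] [y /MP_inversesP[xyx _ _ yxH]] z zxx.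
by rewrite -xyx -(mulrA x) -yxH starM !mulrA zxx mul0r.
Qed.

(** Left multiplication by [y * x] fixes [y * s = m * star x]; the adjoint of this is
    [x * m * star x * star y = x * m]. Hence [y * x * m] equals [y * (x * m * star x) * star y],
    which is visibly self-adjoint. *)
Lemma weighted_outer_inverse (R : nzRingType) (star : R -> R) (m x y s : R) :
    ring_involution star -> star m = m ->
    m * star x = y * s -> y * x * y = y ->
  star (y * x * m) = y * x * m /\ x * y * x * m = x * m.
Proof.
move=> [starK _ starM] mH mx yxy.
have fix_mx : y * x * (m * star x) = m * star x by rewrite mx mulrA yxy.
have xm : x * m * star x * star y = x * m.
  have /(congr1 star) := fix_mx.
  by rewrite !starM starK mH !mulrA.
have yxmH : star (y * x * m) = y * x * m.
  by rewrite -(mulrA y) -xm !starM !starK mH !mulrA.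
split=> //.
have -> : x * y * x * m = x * (y * x * m) by rewrite !mulrA.
by rewrite -yxmH !starM mH !mulrA xm.
Qed.

(** Serves to rewrite a triple product behind a prefix [u], where left association hides it as a
    subterm. *)
Lemma mulr3_after (R : nzRingType) (x y z t : R) :
  x * y * z = t -> forall u, u * x * y * z = u * t.
Proof. by move=> <- u; rewrite !mulrA. Qed.

(* The hypotheses on [p] and [q] say that [p] lies in E R F and [q] in F R E. *)
Lemma MP_inverses_corner (R : nzRingType) (star : R -> R)
    (a ad c cd p q : R) :
    ad * a * p = p -> p * c * cd = p -> c * cd * q = q -> q * ad * a = q ->
  MP_inverses star (a * p * c) (cd * q * ad) <->
  [/\ p * q * p = p, q * p * q = q,
      star (a * p * q * ad) = a * p * q * ad &
      star (cd * q * p * c) = cd * q * p * c].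
Proof.
move=> Ep pF Fq qE; rewrite MP_inversesP.
have -> : a * p * c * (cd * q * ad) = a * p * q * ad.
  by rewrite !mulrA (mulr3_after pF).
have -> : cd * q * ad * (a * p * c) = cd * q * p * c.
  by rewrite !mulrA (mulr3_after qE).
have -> : a * p * q * ad * (a * p * c) = a * (p * q * p) * c.
  by rewrite !mulrA (mulr3_after qE).
have -> : cd * q * p * c * (cd * q * ad) = cd * (q * p * q) * ad.
  by rewrite !mulrA (mulr3_after pF).
split=> [[pqp qpq ? ?]|[-> -> ? ?]]; split=> //.
(* Compression by [ad] and [cd] strips the outer [a] and [c], because [p] lies in the corner. *)
- have /(congr1 (fun t => ad * t * cd)) := pqp.
  by rewrite !mulrA Ep pF !(mulr3_after pF).
- have /(congr1 (fun t => c * t * a)) := qpq.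
  by rewrite !mulrA Fq qE !(mulr3_after qE).
Qed.

Lemma MP_inverses_corner_sub (R : nzRingType) (star : R -> R)
    (a ad c cd p q : R) :
    ring_involution star ->
    ad * a * p = p -> p * c * cd = p -> c * cd * q = q -> q * ad * a = q ->
    MP_inverses star (a * p * c) (cd * q * ad) ->
  (exists r, star q = star a * a * p * r) /\
  (exists s, c * star c * star p = q * s).
Proof.
move=> [_ _ starM] Ep pF Fq qE.
move=> /(MP_inverses_corner star Ep pF Fq qE)[pqp qpq aH cH]; split.
  (* Replacing [a * p * q * ad] by its adjoint turns the product into [star (q * p * q)]. *)
  exists (q * ad * star ad * star q).
  have -> : star a * a * p * (q * ad * star ad * star q) =
            star a * star (a * p * q * ad) * star ad * star q.
    by rewrite aH !mulrA.
  by rewrite -!starM; congr star; rewrite !mulrA qE (mulr3_after qE) qpq.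
exists (p * c * star c * star p).
have -> : q * (p * c * star c * star p) =
          c * star (cd * q * p * c) * star c * star p.
  by rewrite cH !mulrA Fq.
rewrite -!(mulrA c) -!starM; congr (_ * star _).
by rewrite !mulrA pF pqp.
Qed.

Lemma MP_inverses_corner_of_sub (R : nzRingType) (star : R -> R)
    (a ad c cd p q : R) :
    ring_involution star -> MP_inverses star a ad -> MP_inverses star c cd ->
    ad * a * p = p -> p * c * cd = p -> c * cd * q = q -> q * ad * a = q ->
    (exists r, star q = star a * a * p * r) ->
    (exists s, c * star c * star p = q * s) ->
    p * q * p = p \/ q * p * q = q ->
  MP_inverses star (a * p * c) (cd * q * ad).
Proof.
move=> st a_ad c_cd Ep pF Fq qE [r qr] [s ps] pq_inv.
apply/(MP_inverses_corner star Ep pF Fq qE).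
have [starK _ starM] := st.
move: a_ad c_cd => /MP_inversesP[_ a2 a3 _] /MP_inversesP[c1 _ _ c4].
(* Hence [ad * star ad] is the inverse of A in its corner; [cdC] plays the same part for C. *)
have adA u : u * ad * star ad * star a = u * ad.
  by rewrite -(mulrA _ (star ad)) -starM a3 !mulrA (mulr3_after a2).
have cdC u : u * c * star c * star cd = u * c.
  by rewrite -(mulrA _ (star c)) -starM c4 !mulrA (mulr3_after c1).
have AiH : star (ad * star ad) = ad * star ad by rewrite starM starK.
have CH : star (c * star c) = c * star c by rewrite starM starK.
have Aiq : ad * star ad * star q = p * r.
  by rewrite qr -[ad * star ad]mul1r !mulrA adA mul1r Ep.
(* The weight is the inverse of A, with [q] as [x] and [p] as [y]; right multiplication by
   [star a * a] then removes the weight. *)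
have outer_pq : p * q * p = p ->
    star (p * q * (ad * star ad)) = p * q * (ad * star ad) /\ q * p * q = q.
  move=> pqp; have [AH qA] := weighted_outer_inverse st AiH Aiq pqp.
  split=> //; have := congr1 (fun t => t * star a * a) qA.
  by rewrite !mulrA !adA qE (mulr3_after qE).
have outer_qp : q * p * q = q ->
    star (q * p * (c * star c)) = q * p * (c * star c) /\ p * q * p = p.
  move=> qpq; have [CpH pC] := weighted_outer_inverse st CH ps qpq.
  split=> //; have := congr1 (fun t => t * star cd * cd) pC.
  by rewrite !mulrA !cdC pF (mulr3_after pF).
have [pqp qpq] : p * q * p = p /\ q * p * q = q.
  by case: pq_inv => [pqp|qpq];
    [have [] := outer_pq pqp|have [] := outer_qp qpq].
have [AH _] := outer_pq pqp; have [CpH _] := outer_qp qpq.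
split=> //.
(* Self-adjointness passes through the congruence by [a], and below through that by [cd]. *)
- have -> : a * p * q * ad = a * (p * q * (ad * star ad)) * star a.
    by rewrite !mulrA adA.
  by rewrite (starM (a * _)) (starM a) AH starK mulrA.
- have -> : cd * q * p * c = cd * (q * p * (c * star c)) * star cd.
    by rewrite !mulrA cdC.
  by rewrite (starM (cd * _)) (starM cd) CpH starK mulrA.
Qed.

(* Cancellation is applied to z = a p q a^+ - 1, since z abc = a (pqp - p) c. *)
Lemma inner_of_idempotent (R : nzRingType) (star : R -> R)
    (a ad c cd p q : R) :
    ring_involution star ->
    ad * a * p = p -> p * c * cd = p -> q * ad * a = q ->
    right_star_cancellable star (a * p * c) -> p * q = (p * q) ^+ 2 ->
    (exists s, c * star c * star p = q * s) ->
  p * q * p = p.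
Proof.
move=> [_ _ starM] Ep pF qE canc pq2 [s ps].
have := canc (a * p * q * ad - 1).
have -> : (a * p * q * ad - 1) * (a * p * c) = a * (p * q * p) * c - a * p * c.
  by rewrite mulrBl mul1r !mulrA (mulr3_after qE).
(* The inclusion writes [c * star c * star p] as [q * s], which supplies the [q] needed to apply
   idempotency after [p * q * p]. *)
have pqpqs : p * q * p * q * s = p * q * s.
  by rewrite [in RHS]pq2 expr2 !mulrA.
have <- : a * (p * q * p * q * s) * star a - a * (p * q * s) * star a =
          (a * (p * q * p) * c - a * p * c) * star (a * p * c).
  by rewrite mulrBl -!(mulrA _ q s) -ps !starM !mulrA.
rewrite pqpqs subrr => /(_ erefl)/eqP; rewrite subr_eq0.
move=> /eqP/(congr1 (fun t => ad * t * cd)).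
by rewrite !mulrA Ep pF (mulr3_after pF).
Qed.

Theorem theorem2p3 (R : nzRingType) (star : R -> R)
    (star_inv : ring_involution star) (a b c bt : R)
    (a_MP : MP_invertible star a) (c_MP : MP_invertible star c) :
  let ad := MP_inv star a in
  let cd := MP_inv star c in
  let p := ad * a * b * c * cd in
  let q := c * cd * bt * ad * a in
  [<->
    (* (i) *)
    MP_invertible star (a * b * c) /\ MP_inv star (a * b * c) = cd * bt * ad;
    (* (iv) *)
    [/\ q \in inverses1 p,
        right_ideal (star q) `<=` right_ideal (star a * a * p) &
        right_ideal (c * star c * star p) `<=` right_ideal q];
    (* (v) *)
    [/\ right_star_cancellable star (a * b * c),
        p * q = (p * q) ^+ 2,
        right_ideal (star q) `<=` right_ideal (star a * a * p) &
        right_ideal (c * star c * star p) `<=` right_ideal q];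
    (* (vi) *)
    [/\ q \in inverses2 p,
        right_ideal (star q) `<=` right_ideal (star a * a * p) &
        right_ideal (c * star c * star p) `<=` right_ideal q]].
Proof.
move=> ad cd p q.
have a_ad : MP_inverses star a ad := MP_invP a_MP.
have c_cd : MP_inverses star c cd := MP_invP c_MP.
have [a1 a2 _ _] := (MP_inversesP _ _ _).1 a_ad.
have [c1 c2 _ _] := (MP_inversesP _ _ _).1 c_cd.
have Ep : ad * a * p = p by rewrite /p !mulrA a2.
have pF : p * c * cd = p by rewrite /p (mulr3_after c1).
have Fq : c * cd * q = q by rewrite /q !mulrA c1.
have qE : q * ad * a = q by rewrite /q (mulr3_after a2).
have xE : a * b * c = a * p * c by rewrite /p !mulrA a1 (mulr3_after c1).
have yE : cd * bt * ad = cd * q * ad.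
  by rewrite /q !mulrA c2 (mulr3_after a2).
(* From here [b] and [bt] enter only through [p] and [q], known by their four corner identities. *)
clearbody p q; rewrite {}xE {}yE.
rewrite !right_ideal_subE /inverses1 /inverses2 !in_setE /=.
pose i_eq := MP_inverses_corner star Ep pF Fq qE.
have to_i := MP_inverses_corner_of_sub star_inv a_ad c_cd Ep pF Fq qE.
have from_i := MP_inverses_corner_sub star_inv Ep pF Fq qE.
tfae.
- move=> [x_MP yE]; have := MP_invP x_MP; rewrite yE => xy.
  by have [? ?] := from_i xy; have [] := i_eq.1 xy.
- move=> [pqp sub1 sub2]; have xy := to_i sub1 sub2 (or_introl pqp).
  split=> //; last by rewrite expr2 mulrA pqp.
  by apply: MP_invertible_right_star_cancellable => //; exists (cd * q * ad).
(* Cancellation yields the inner identity, which gives (i); the outer identity is then one of the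
   Penrose equations. *)
- move=> [canc pq2 sub1 sub2].
  have pqp := inner_of_idempotent star_inv Ep pF qE canc pq2 sub2.
  by have [] := i_eq.1 (to_i sub1 sub2 (or_introl pqp)).
- move=> [qpq sub1 sub2]; have xy := to_i sub1 sub2 (or_intror qpq).
  by split; [exists (cd * q * ad)|exact: MP_inv_uniq].
Qed.
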